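(* Let $p\ge1$ and let $\mathfrak g$ be a $(2p+1)$-dimensional $k$-step nilpotent Lie algebra over $\mathbb K$ ($\mathbb K=\mathbb R$ or $\mathbb C$). Then there exists a contact form on $\mathfrak g$ if and only if $\mathfrak g$ is a central extension of a $2p$-dimensional $(k-1)$-step nilpotent symplectic Lie algebra $\mathfrak h$, the extension being defined by the $2$-cocycle given by the symplectic form.
   Context: For a Lie algebra $\mathfrak g$ and $\omega\in\mathfrak g^*$, $d\omega(X,Y)=-\omega([X,Y])$. A contact form on a $(2p+1)$-dimensional Lie algebra $\mathfrak g$ is a linear form $\omega\in\mathfrak g^*$ with $\omega\wedge(d\omega)^p\neq0$. A nilpotent Lie algebra is $k$-step nilpotent if its nilindex is (exactly) $k$. A symplectic Lie algebra is a $2p$-dimensional Lie algebra $\mathfrak h$ with a nondegenerate skew-symmetric bilinear form $\theta$ which is closed: $\theta([X,Y],Z)+\theta([Y,Z],X)+\theta([Z,X],Y)=0$ for all $X,Y,Z\in\mathfrak h$. The central extension of $\mathfrak h$ defined by $\theta$ is the Lie algebra $\mathfrak h\oplus\mathbb K Z$ with bracket $[X,Y]=[X,Y]_{\mathfrak h}+\theta(X,Y)Z$ for $X,Y\in\mathfrak h$, and $Z$ central. *)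

(* Defs.v *)
From HB Require Import structures.
From mathcomp Require Import all_boot all_order all_fingroup all_algebra.
From mathcomp Require Export reals complex.

Set Implicit Arguments.
Unset Strict Implicit.
Unset Printing Implicit Defensive.

Import GRing.Theory Num.Theory.
Local Open Scope ring_scope.

HB.mixin Record Vector_isLieAlgebra (K : fieldType) g of Vector K g := {
  lie_bracket : g -> g -> g;
  lie_bracket_bilinear : bilinear_for *:%R *:%R lie_bracket;
  lie_bracketxx : forall x, lie_bracket x x = 0;
  lie_jacobi : forall x y z,
    lie_bracket x (lie_bracket y z) + lie_bracket y (lie_bracket z x)
      + lie_bracket z (lie_bracket x y) = 0
}.

#[short(type="lieAlgType")]
HB.structure Definition LieAlgebra (K : fieldType) :=
  {g of Vector K g & Vector_isLieAlgebra K g}.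

Notation "[ 'lie' x , y ]" := (lie_bracket x y) (format "[ 'lie'  x ,  y ]")
  : ring_scope.

HB.instance Definition _ (K : fieldType) (g : lieAlgType K) :=
  bilinear_isBilinear.Build K g g g *:%R *:%R (@lie_bracket K g)
    lie_bracket_bilinear.

Definition lie_isomorphic (K : fieldType) (g1 g2 : lieAlgType K) : Prop :=
  exists f : {linear g1 -> g2},
    bijective f /\ {morph f : x y / [lie x, y] >-> [lie x, y]}.

Section LowerCentralSeries.
Variables (K : fieldType) (g : lieAlgType K).
Implicit Types U V W : {vspace g}.

Definition lie_prodv U V : {vspace g} :=
  <<allpairs (@lie_bracket K g) (vbasis U) (vbasis V)>>%VS.

Lemma memv_lie U V u v : u \in U -> v \in V -> [lie u, v] \in lie_prodv U V.
Proof.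
move=> /coord_vbasis-> /coord_vbasis->.
rewrite linear_sumr rpred_sum // => i _; rewrite linear_sumlz rpred_sum // => j _.
rewrite linearZl_LR linearZr_LR !memvZ // memv_span //.
by apply/allpairsP; exists ((vbasis U)`_j, (vbasis V)`_i);
   rewrite !mem_nth ?size_tuple.
Qed.

Lemma lie_prodvP U V W :
  reflect {in U & V, forall u v, [lie u, v] \in W} (lie_prodv U V <= W)%VS.
Proof.
apply: (iffP idP) => [sUVW u v Uu Vv | sUVW].
  by apply: (subvP sUVW); apply: memv_lie.
apply/span_subvP => _ /allpairsP[[u v] /= [Uu Vv ->]].
by rewrite sUVW ?vbasis_mem.
Qed.

(* The series starts with g itself at index 0, so that a nonzero abelian
   algebra is 1-step nilpotent and only the zero algebra is 0-step. *)
Fixpoint lower_central n : {vspace g} :=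
  if n is m.+1 then lie_prodv fullv (lower_central m) else fullv.

Definition step_nilpotent k : Prop :=
  lower_central k = 0%VS /\ forall i, (i < k)%N -> lower_central i <> 0%VS.

End LowerCentralSeries.

Section Forms.
Variables (K : fieldType) (V : lmodType K).

(* Multilinearity and alternation are not recorded: the operations below are
   only applied to forms which have these properties. *)
Definition kform n := ('I_n -> V) -> K.

Definition form1 (w : {scalar V}) : kform 1 := fun v => w (v ord0).

(* (a ^ b)(v_1, ..., v_(k+l)) is
   1/(k! l!) \sum_s sgn(s) a(v_s(1), ..., v_s(k)) b(v_s(k+1), ..., v_s(k+l)). *)
Definition wedge k l (a : kform k) (b : kform l) : kform (k + l) := fun v =>
  (k`! * l`!)%:R^-1 *
  \sum_(s : 'S_(k + l)) (-1) ^+ s * a (fun i => v (s (lshift l i)))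
                                  * b (fun j => v (s (rshift k j))).

Fixpoint wedge_exp k (a : kform k) p : kform (p * k) :=
  if p is q.+1 then wedge a (@wedge_exp k a q) else fun=> 1.

End Forms.
Arguments wedge_exp {K V k} a p.

Definition dform1 (K : fieldType) (g : lieAlgType K) (w : {scalar g}) :
  kform g 2 := fun v => - w [lie v ord0, v ord_max].

Definition contact_form (K : fieldType) (g : lieAlgType K) p (w : {scalar g}) :
  Prop := exists v, wedge (form1 w) (wedge_exp (dform1 w) p) v != 0.

Section CentralExtension.
Variables (K : numFieldType) (h : lieAlgType K).

Record cocycle2 := Cocycle2 {
  cocycle_form :> {skew_symmetric h};
  cocycle_closed : forall x y z,
    cocycle_form [lie x, y] z + cocycle_form [lie y, z] x
      + cocycle_form [lie z, x] y = 0
}.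

Record symplectic_form := SymplecticForm {
  symplectic_cocycle :> cocycle2;
  symplectic_nondegenerate : nondegenerate symplectic_cocycle
}.

Definition central_ext of cocycle2 : Type := (h * K^o)%type.

Variable theta : cocycle2.

HB.instance Definition _ := Vector.copy (central_ext theta) (h * K^o)%type.

Definition central_bracket (u v : central_ext theta) : central_ext theta :=
  ([lie u.1, v.1], theta u.1 v.1).

Fact central_bracket_bilinear : bilinear_for *:%R *:%R central_bracket.
Proof.
split=> u a x y; congr pair.
- by rewrite linearDl linearZl_LR.
- by rewrite linearDl linearZl_LR.
- by rewrite linearDr linearZr_LR.
- by rewrite linearDr linearZr_LR.
Qed.

Fact central_bracketxx u : central_bracket u u = 0.
Proof.
congr pair; first exact: lie_bracketxx.
have /eqP := @hermitian_subproof _ _ _ _ theta u.1 u.1.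
by rewrite expr1 mulN1r -addr_eq0 -mulr2n mulrn_eq0 => /eqP.
Qed.

Fact central_jacobi x y z :
  central_bracket x (central_bracket y z)
    + central_bracket y (central_bracket z x)
    + central_bracket z (central_bracket x y) = 0.
Proof.
congr pair; first exact: lie_jacobi.
have C a b : theta a b = - theta b a.
  by rewrite [LHS]hermitian_subproof expr1 mulN1r.
rewrite /= (C x.1) (C y.1) (C z.1) -!opprD.
by rewrite [_ + theta _ z.1]addrC addrA cocycle_closed oppr0.
Qed.

HB.instance Definition _ := Vector_isLieAlgebra.Build K (central_ext theta)
  central_bracket_bilinear central_bracketxx central_jacobi.

End CentralExtension.

(* Main.v *)
(* If w is contact, no nonzero y satisfies w(y) = 0 and w([y, .]) = 0: otherwise
   the top-degree form w ^ (dw)^p, being multilinear and alternating, would be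
   pulled back from a space of dimension 2p.  Hence w is injective on the
   centre, which nilpotency makes a line K z with w(z) = 1, and the quotient by
   K z with the form w([., .]) is the required symplectic algebra.  Conversely,
   the coordinate along the added central line is a contact form, as w ^ (dw)^p
   is positive on the central vector followed by a Darboux basis. *)
From HB Require Import structures.
Require Import Defs.
From mathcomp Require Import all_boot all_order all_fingroup all_algebra.
From mathcomp Require boolp.
From mathcomp Require Import zify.

Set Implicit Arguments.
Unset Strict Implicit.
Unset Printing Implicit Defensive.

Import Order.TTheory GRing.Theory Num.Theory.
Local Open Scope ring_scope.

(** * Multilinear alternating forms, their radicals and wedge products *)

Section MultilinearForms.
Variables (K : fieldType) (V : lmodType K).

Definition set_slot n (v : 'I_n -> V) i x : 'I_n -> V :=
  fun j => if j == i then x else v j.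

Lemma set_slot_id n (v : 'I_n -> V) i : set_slot v i (v i) = v.
Proof. by apply: boolp.funext => j; rewrite /set_slot; case: eqP => // ->. Qed.

Definition multilinear n (a : kform V n) := forall i v c x y,
  a (set_slot v i (c *: x + y)) = c * a (set_slot v i x) + a (set_slot v i y).

Definition antisymmetric_form n (a : kform V n) := forall (s : 'S_n) v,
  a (fun i => v (s i)) = (-1) ^+ s * a v.

Definition in_radical n (a : kform V n) y := forall i v, a (set_slot v i y) = 0.

(** In the summand of [s], argument [i] is read only at position [s^-1 i], hence by exactly one
    factor. Slotwise properties of the wedge thus reduce to those of one factor. *)
Lemma wedge_slot k l (s : 'S_(k + l)) i :
  (exists j, forall v x,
    (fun t => set_slot v i x (s (lshift l t)))
      = set_slot (fun t => v (s (lshift l t))) j x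
    /\ (fun t => set_slot v i x (s (rshift k t)))
      = (fun t => v (s (rshift k t))))
  \/ (exists j, forall v x,
    (fun t => set_slot v i x (s (lshift l t)))
      = (fun t => v (s (lshift l t)))
    /\ (fun t => set_slot v i x (s (rshift k t)))
      = set_slot (fun t => v (s (rshift k t))) j x).
Proof.
have <- := permKV s i; case: (split_ordP (s^-1%g i)) => j ->; [left|right];
  exists j => v x; split; apply: boolp.funext => t;
  by rewrite /set_slot (inj_eq perm_inj)
     ?eq_lshift ?eq_rshift ?eq_lrshift ?eq_rlshift.
Qed.

Lemma wedge_multilinear k l (a : kform V k) (b : kform V l) :
  multilinear a -> multilinear b -> multilinear (wedge a b).
Proof.
move=> aL bL i v c x y; rewrite /wedge mulrCA -mulrDr; congr (_ * _).
rewrite mulr_sumr -big_split; apply: eq_bigr => s _ /=.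
have [[j E]|[j E]] := wedge_slot s i.
  have [-> ->] := E v (c *: x + y); have [-> ->] := E v x.
  have [-> ->] := E v y; rewrite aL mulrDr mulrDl; congr (_ + _).
  by rewrite mulrCA -!mulrA.
have [-> ->] := E v (c *: x + y); have [-> ->] := E v x.
have [-> ->] := E v y; rewrite bL mulrDr; congr (_ + _).
by rewrite mulrCA.
Qed.

Lemma wedge_in_radical k l (a : kform V k) (b : kform V l) y :
  in_radical a y -> in_radical b y -> in_radical (wedge a b) y.
Proof.
move=> a0 b0 i v; rewrite /wedge big1 ?mulr0 // => s _.
by have [[j E]|[j E]] := wedge_slot s i; have [-> ->] := E v y;
  rewrite ?a0 ?b0 !(mulr0, mul0r).
Qed.

(** Nothing is asked of the factors: the sum over all permutations antisymmetrises by itself, as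
    reindexing by $t\mapsto ts^{-1}$ shows. *)
Lemma wedge_antisymmetric k l (a : kform V k) (b : kform V l) :
  antisymmetric_form (wedge a b).
Proof.
move=> s v; rewrite /wedge mulrCA; congr (_ * _).
rewrite mulr_sumr (reindex_inj (mulIg s^-1%g)) /=.
apply: eq_bigr => t _.
rewrite odd_permM odd_permV signr_addb [_ * (-1) ^+ s]mulrC -!mulrA.
have tsE i : s ((t * s^-1)%g i) = t i by rewrite permM permKV.
by under [X in a X]boolp.eq_fun do rewrite tsE;
   under [X in b X]boolp.eq_fun do rewrite tsE.
Qed.

Lemma wedge_exp_multilinear k (a : kform V k) p :
  multilinear a -> multilinear (wedge_exp a p).
Proof. by move=> aL; elim: p => [[]//|p IHp]; exact: wedge_multilinear. Qed.

Lemma wedge_exp_in_radical k (a : kform V k) p y :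
  in_radical a y -> in_radical (wedge_exp a p) y.
Proof. by move=> a0; elim: p => [[]//|p IHp]; exact: wedge_in_radical. Qed.

Lemma wedge_exp_antisymmetric k (a : kform V k) p :
  antisymmetric_form (wedge_exp a p).
Proof.
case: p => [s v|p]; last exact: wedge_antisymmetric.
(* The zeroth power is the constant form, not a wedge; there the only permutation is the
   identity. *)
have -> : s = 1%g by apply/permP => -[].
by rewrite odd_perm1 mulr1.
Qed.

Lemma antisymmetric_eq_slots n (a : kform V n) (v : 'I_n -> V) i j :
  2%:R != 0 :> K -> antisymmetric_form a -> i != j -> v i = v j -> a v = 0.
Proof.
move=> two_neq0 aA ij vij; have := aA (tperm i j) v.
rewrite odd_tperm ij expr1 mulN1r (_ : (fun _ => _) = v).
  move/eqP; rewrite -addr_eq0 -mulr2n -mulr_natl mulf_eq0 (negPf two_neq0).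
  by move=> /eqP.
by apply: boolp.funext => k; case: tpermP => [->|->|].
Qed.

Lemma multilinear0 n (a : kform V n) i v :
  multilinear a -> a (set_slot v i 0) = 0.
Proof.
by move=> aL; have := aL i v (-1) 0 0; rewrite scaler0 addr0 mulN1r addNr.
Qed.

Lemma multilinear_sum n (a : kform V n) i v (I : finType) (c : I -> K) x :
  multilinear a -> a (set_slot v i (\sum_j c j *: x j))
                     = \sum_j c j * a (set_slot v i (x j)).
Proof.
move=> aL; apply: esym; elim/big_rec2: _ => [|j s t _ ->]; last by rewrite aL.
by rewrite multilinear0.
Qed.

End MultilinearForms.

(** If $y\neq0$, then [y] and the [v i] are $n+1$ independent vectors, against the dimension
    bound. *)
Lemma antisymmetric_form_radical (K : fieldType) (V : vectType K) n
    (a : kform V n) v y :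
    2%:R != 0 :> K -> (\dim {:V} <= n)%N ->
    multilinear a -> antisymmetric_form a -> in_radical a y -> a v != 0 ->
  y = 0.
Proof.
move=> two_neq0 dimV aL aA a_y av; apply/eqP; apply: contraLR dimV => y_neq0.
pose X := [tuple of y :: [tuple v i | i < n]].
suff /eqP freeX : free X.
  by rewrite -ltnNge -[n.+1](size_tuple X) -freeX dimvS ?subvf.
apply/freeP => k; rewrite big_ord_recl.
have XE i : X`_(lift ord0 i) = v i.
  by rewrite lift0 /= -(tnth_nth 0 [tuple v i | i < n] i) tnth_mktuple.
under eq_bigr do rewrite XE.
move=> sum0; have k_lift i : k (lift ord0 i) = 0.
  (* The relation is put into slot [i]: the [y] term dies by the radical, the terms $j\neq i$ by a
     repeated argument, and $k_i\,a(v)=0$ remains. *)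
  have /eqP := aL i v (k ord0) y (\sum_j k (lift ord0 j) *: v j).
  rewrite sum0 a_y mulr0 add0r multilinear_sum // (bigD1 i) //= set_slot_id.
  rewrite big1 => [|j ji].
    by rewrite multilinear0 // addr0 eq_sym mulf_eq0 (negPf av) orbF => /eqP.
  rewrite (antisymmetric_eq_slots two_neq0 aA ji) ?mulr0 //.
  by rewrite /set_slot (negPf ji) eqxx.
move=> i; have [j ->|->] := unliftP ord0 i; first exact: k_lift.
move/eqP: sum0; rewrite big1 ?addr0; last by move=> j _; rewrite k_lift scale0r.
by rewrite scaler_eq0 (negPf y_neq0) orbF => /eqP.
Qed.

(** * Positivity of wedge products on Darboux families *)

Lemma perm_fix0P n (s : 'S_n.+1) :
  s ord0 = ord0 -> exists t, s = lift_perm ord0 ord0 t.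
Proof.
(* The default [k] is never reached: [s] fixes 0, so it sends no other index to 0. *)
move=> s0; pose f k := odflt k (unlift ord0 (s (lift ord0 k))).
have fE k : s (lift ord0 k) = lift ord0 (f k).
  have := neq_lift ord0 k; rewrite -(inj_eq (@perm_inj _ s)) s0 /f.
  by case/unlift_some => j -> ->.
have f_inj : injective f.
  by move=> j k /(congr1 (lift ord0)); rewrite -!fE => /perm_inj /lift_inj.
exists (perm f_inj); apply/permP => i.
have [j ->|->] := unliftP ord0 i; last by rewrite lift_perm_id.
by rewrite lift_perm_lift permE fE.
Qed.

(** Stated on natural numbers so that [lia] can decide facts about products of transpositions. *)
Lemma tperm_valP n (i j k : 'I_n) (r := nat_of_ord (tperm i j k)) :
  (k = i :> nat /\ r = j) \/ (k = j :> nat /\ r = i)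
    \/ (k <> i :> nat /\ k <> j :> nat /\ r = k).
Proof.
rewrite /r; case: tpermP => [->|->|ki kj]; [by left|by right; left|].
by right; right; do 2?split=> //; move/val_inj.
Qed.

Section Positivity.
Variables (K : numFieldType) (V : lmodType K).

Lemma wedge_gt0 k l (a : kform V k) (b : kform V l) v :
    let F (s : 'S_(k + l)) := (-1) ^+ s * a (fun i => v (s (lshift l i)))
                                  * b (fun j => v (s (rshift k j))) in
    (forall s, 0 <= F s) -> 0 < F 1%g ->
  0 < wedge a b v.
Proof.
move=> F F_ge0 F1_gt0; rewrite /wedge mulr_gt0 //.
  by rewrite invr_gt0 ltr0n muln_gt0 !fact_gt0.
rewrite (bigD1 1%g) //= ltr_pwDl // sumr_ge0 // => s _; exact: F_ge0.
Qed.

(** Only permutations fixing 0 contribute, as [w] kills the other vectors. For these the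
    antisymmetry of [b] cancels the signature, so their summands are all equal and positive. *)
Lemma wedge_form1_gt0 (w : {scalar V}) l (b : kform V l) v :
    antisymmetric_form b ->
    0 < w (v ord0) -> (forall i, w (v (rshift 1 i)) = 0) ->
    0 < b (fun i => v (rshift 1 i)) ->
  0 < wedge (form1 w) b v.
Proof.
move=> bA w0 w_rest b_gt0.
have l0 : lshift l ord0 = ord0 :> 'I_(1 + l) by apply: val_inj.
have rE (i : 'I_l) : rshift 1 i = lift ord0 i by apply: val_inj.
apply: wedge_gt0 => [s|]; rewrite /form1 l0; last first.
  rewrite odd_perm1 mul1r perm1 mulr_gt0 //.
  by under [X in b X]boolp.eq_fun do rewrite perm1.
have [s0|] := eqVneq (s ord0) ord0; last first.
  by rewrite eq_sym => /unlift_some[i -> _]; have := w_rest i; rewrite rE => ->;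
     rewrite mulr0 mul0r.
have [t ->] := perm_fix0P s0; rewrite lift_perm_id.
have tE i : lift_perm ord0 ord0 t (rshift 1 i) = rshift 1 (t i).
  by apply: val_inj; rewrite rE lift_perm_lift.
under [X in b X]boolp.eq_fun do rewrite tE.
rewrite (bA t (fun i => v (rshift 1 i))) odd_lift_perm /= mulrACA.
by rewrite -expr2 sqrr_sign mul1r mulr_ge0 ?ltW.
Qed.

Variable B : V -> V -> K.

Definition form2 : kform V 2 := fun v => B (v ord0) (v ord_max).

(** [B] is an arbitrary function, so both orders of the pairing are recorded. Indexing by [nat]
    allows shifting and renumbering without casts. *)
Definition darboux q (x y : nat -> V) := forall i j, (i < q)%N -> (j < q)%N ->
  [/\ B (x i) (x j) = 0, B (y i) (y j) = 0, B (x i) (y j) = (i == j)%:R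
    & B (y i) (x j) = - (i == j)%:R].

(** The order $x_0,y_0,x_1,y_1,\dots$ lets the first factor of a power of [form2] read the first
    pair in the identity summand. *)
Definition interleave (x y : nat -> V) i := (if odd i then y else x) i./2.

Lemma interleave_behead x y i :
  interleave x y i.+2 = interleave (x \o succn) (y \o succn) i.
Proof. by rewrite /interleave /= negbK; case: odd. Qed.

Lemma darboux_behead q x y :
  darboux q.+1 x y -> darboux q (x \o succn) (y \o succn).
Proof. by move=> D i j iq jq; exact: (D i.+1 j.+1). Qed.

Lemma darboux_comp q x y f :
    injective f -> (forall i, (i < q)%N -> (f i < q)%N) ->
  darboux q x y -> darboux q (x \o f) (y \o f).
Proof.
by move=> f_inj fq D i j iq jq; rewrite -(inj_eq f_inj); apply: D; apply: fq.
Qed.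

(* All summands of the wedge product turn out to be nonnegative, so that no
   counting of permutations is needed.  If s 0 and s 1 are the two indices of
   the m-th pair of the family, composing s with the even permutation that
   exchanges the pairs 0 and m amounts to permuting the Darboux family, and
   reduces to the case where s fixes 0 and 1. *)
Lemma wedge_exp_form2_gt0 q x y : darboux q x y ->
  0 < wedge_exp form2 q (fun i => interleave x y i).
Proof.
elim: q x y => [|q IHq] x y D; first exact: ltr01.
pose o0 : 'I_(2 + q * 2) := ord0; pose o1 : 'I_(2 + q * 2) := lift ord0 ord0.
have o0E : o0 = 0%N :> nat by [].
have o1E : o1 = 1%N :> nat by [].
(* The family stays a parameter because exchanging pairs changes it. *)
pose F x y (s : 'S_(2 + q * 2)) :=
  (-1) ^+ s * B (interleave x y (s o0)) (interleave x y (s o1))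
    * wedge_exp form2 q (fun j => interleave x y (s (rshift 2 j))).
have l0 : lshift (q * 2) ord0 = o0 by apply: val_inj.
have l1 : lshift (q * 2) ord_max = o1 by apply: val_inj.
have rE (j : 'I_(q * 2)) :
  rshift 2 j = lift ord0 (lift ord0 j) :> 'I_(q * 2).+2 by exact: val_inj.
(* Here [s] permutes only the remaining slots; its sign cancels by antisymmetry, leaving
   $B(x_0,y_0)=1$ times the induction hypothesis. *)
have F_fix x' y' (s : 'S_(2 + q * 2)) : darboux q.+1 x' y' ->
    s o0 = o0 -> s o1 = o1 -> 0 < F x' y' s.
  move=> D' s0; have [t ->] := perm_fix0P s0.
  rewrite {1}/o1 lift_perm_lift => /lift_inj t0.
  have [r ->] := perm_fix0P t0; rewrite /F.
  rewrite lift_perm_id lift_perm_lift lift_perm_id.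
  have rsE j : lift_perm ord0 ord0 (lift_perm ord0 ord0 r) (rshift 2 j)
      = rshift 2 (r j) by apply: val_inj; rewrite rE !lift_perm_lift.
  under [X in wedge_exp _ _ X]boolp.eq_fun do rewrite rsE.
  have -> := wedge_exp_antisymmetric form2 r
    (fun j : 'I_(q * 2) => interleave x' y' (rshift 2 j)).
  have [_ _ + _] := D' 0 0 isT isT; rewrite eqxx => B01.
  rewrite (_ : B _ _ = 1%:R); last exact: B01.
  rewrite mulr1 mulrA !odd_lift_perm /= -expr2 sqrr_sign mul1r.
  under boolp.eq_fun do rewrite interleave_behead.
  exact: (IHq _ _ (darboux_behead D')).
have F_ord x' y' (s : 'S_(2 + q * 2)) m : darboux q.+1 x' y' ->
    s o0 = m.*2 :> nat -> s o1 = m.*2.+1 :> nat -> 0 < F x' y' s.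
  move=> D' s0 s1; pose d := (tperm o0 (s o0) * tperm o1 (s o1))%g.
  (* The action of [d] on pair numbers; for $m=0$ both are the identity. *)
  pose f i := if i == 0%N then m else if i == m then 0%N else i.
  have mq : (m < q.+1)%N by have := ltn_ord (s o0); rewrite s0; lia.
  have fP i : (i = 0%N /\ f i = m) \/ (i = m /\ f i = 0%N)
      \/ (i <> 0%N /\ i <> m /\ f i = i).
    rewrite /f; have [->|/eqP i0] := eqVneq i 0%N; first by left.
    have [->|/eqP im] := eqVneq i m; first by right; left.
    by right; right.
  have fK : involutive f.
    by move=> i; have := fP i; have := fP (f i); lia.
  have dE (k : 'I_(2 + q * 2)) : odd (d k) = odd k /\ f (d k)./2 = k./2.
    have := tperm_valP o1 (s o1) (tperm o0 (s o0) k).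
    have := tperm_valP o0 (s o0) k; have := fP (d k)./2.
    rewrite /d permM s0 s1 o0E o1E.
    move: (f _) => e; move: (nat_of_ord (tperm o1 _ _)) => c.
    move: (nat_of_ord (tperm o0 _ _)) (nat_of_ord k) => b a; lia.
  have uE k : interleave (x' \o f) (y' \o f) (d k) = interleave x' y' k.
    by have [Eo Eh] := dE k; rewrite /interleave Eo; case: odd; rewrite /= Eh.
  (* The two transpositions are both trivial if $m=0$ and both proper otherwise. *)
  have odd_d : odd_perm d = false.
    rewrite odd_permM !odd_tperm -!(inj_eq (@ord_inj _)) s0 s1 o0E o1E; lia.
  have -> : F x' y' s = F (x' \o f) (y' \o f) (s * d)%g.
    have sdE j : interleave (x' \o f) (y' \o f) ((s * d)%g j)
        = interleave x' y' (s j) by rewrite permM uE.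
    rewrite /F odd_permM odd_d addbF !sdE.
    by under [X in _ = _ * wedge_exp _ _ X]boolp.eq_fun do rewrite sdE.
  apply: F_fix.
  - apply: darboux_comp D' => [|i iq]; first exact: inv_inj.
    have := fP i; lia.
  - apply: ord_inj; have := tperm_valP o1 (s o1) (tperm o0 (s o0) (s o0)).
    have := tperm_valP o0 (s o0) (s o0); rewrite /d !permM s0 s1 o0E o1E.
    move: (nat_of_ord (tperm o1 _ _)) (nat_of_ord (tperm o0 _ _)) => b a; lia.
  - apply: ord_inj; have := tperm_valP o1 (s o1) (tperm o0 (s o0) (s o1)).
    have := tperm_valP o0 (s o0) (s o1); rewrite /d !permM s0 s1 o0E o1E.
    move: (nat_of_ord (tperm o1 _ _)) (nat_of_ord (tperm o0 _ _)) => b a; lia.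
(* Precomposing with the transposition of slots 0 and 1 flips both the signature and the sign of
   [B], so the summand is unchanged. *)
have F_swap (s : 'S_(2 + q * 2)) m :
    s o0 = m.*2.+1 :> nat -> s o1 = m.*2 :> nat -> 0 < F x y s.
  move=> s0 s1; pose s' := (tperm o0 o1 * s)%g.
  have s'0 : s' o0 = s o1 by rewrite permM tpermL.
  have s'1 : s' o1 = s o0 by rewrite permM tpermR.
  have mq : (m < q.+1)%N by have := ltn_ord (s o0); rewrite s0; lia.
  have : 0 < F x y s' by apply: (F_ord _ _ _ m); rewrite ?s'0 ?s'1.
  have s'E j : s' (rshift 2 j) = s (rshift 2 j) by rewrite permM tpermD.
  rewrite /F s'0 s'1 odd_permM odd_tperm /=.
  under boolp.eq_fun do rewrite s'E.
  rewrite /interleave s0 s1 /= odd_double uphalf_double half_double.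
  have [_ _ -> ->] := D _ _ mq mq.
  by rewrite eqxx signrN mulr1 mulrN1.
apply: wedge_gt0 => [s|]; rewrite /form2 l0 l1; last first.
  exact: F_fix D (perm1 _) (perm1 _).
rewrite -/(F x y s).
have sq i : ((s i)./2 < q.+1)%N by have := ltn_ord (s i); lia.
(* A nonzero value of [B] forces the two indices to form one pair, in one order or the other. *)
have [Bs0|] := eqVneq (B (interleave x y (s o0)) (interleave x y (s o1))) 0.
  by rewrite /F Bs0 mulr0 mul0r.
rewrite /interleave; have [Bxx Byy Bxy Byx] := D _ _ (sq o0) (sq o1).
have Es i := odd_double_half (s i).
case: ifP (Es o0) => odd0 E0; case: ifP (Es o1) => odd1 E1.
- by rewrite Byy eqxx.
- rewrite Byx oppr_eq0 pnatr_eq0 eqb0 negbK => /eqP E.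
  by apply/ltW/(F_swap _ (s o0)./2); lia.
- rewrite Bxy pnatr_eq0 eqb0 negbK => /eqP E.
  by apply/ltW/(F_ord _ _ _ (s o0)./2) => //; lia.
by rewrite Bxx eqxx.
Qed.

End Positivity.

(** * Darboux families of skew forms, and contact forms on central extensions *)

Lemma skewC (K : fieldType) (V : lmodType K) (theta : {skew_symmetric V}) x y :
  theta x y = - theta y x.
Proof. by rewrite [LHS]hermitian_subproof expr1 mulN1r. Qed.

Lemma skewxx (K : numFieldType) (V : lmodType K) (theta : {skew_symmetric V})
    x :
  theta x x = 0.
Proof.
by have /eqP := skewC theta x x; rewrite -addr_eq0 -mulr2n mulrn_eq0 => /eqP.
Qed.

(** Symplectic Gram-Schmidt: split off a hyperbolic pair and recurse on its orthogonal in [U], which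
    loses at most two dimensions and stays nondegenerate. *)
Lemma darboux_exists (K : numFieldType) (V : vectType K)
    (theta : {skew_symmetric V}) q (U : {vspace V}) :
    (q * 2 <= \dim U)%N ->
    (forall u, u \in U -> (forall v, v \in U -> theta u v = 0) -> u = 0) ->
  exists x y, darboux theta q x y /\
    forall i, (i < q)%N -> x i \in U /\ y i \in U.
Proof.
elim: q U => [|q IHq] U dimU ndU; first by exists (fun=> 0), (fun=> 0).
pose e := vpick U.
have e_neq0 : e != 0.
  by rewrite vpick0 -dimv_eq0; apply: contraTneq dimU => ->.
have Ue : e \in U by apply: memv_pick.
have [f Uf ef] : exists2 f, f \in U & theta e f = 1.
  have [f /andP[Uf ef]] : exists f, (f \in U) && (theta e f != 0).
    apply: boolp.contrapT => /boolp.forallNP no_f; case/eqP: e_neq0.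
    apply: ndU => // v Uv; apply/eqP.
    by have := no_f v; rewrite Uv => /negP/negPn.
  exists ((theta e f)^-1 *: f); first exact: memvZ.
  by rewrite linearZr_LR /= mulVf.
pose U' := (U :&: orthov theta <[e]> :&: orthov theta <[f]>)%VS.
have U'P u : (u \in U') = [&& u \in U, theta u e == 0 & theta u f == 0].
  by rewrite !memv_cap !mem_orthov1 andbA.
have [||x [y [D xyU]]] := IHq U'.
- have := leq_dim_orthov1 theta f (U :&: orthov theta <[e]>).
  have := leq_dim_orthov1 theta e U; rewrite -/U'; lia.
- move=> u; rewrite U'P => /and3P[Uu /eqP ue /eqP uf] u0; apply: ndU => // v Uv.
  (* The component of [v] orthogonal to [e] and [f]; since [u] is orthogonal to both, [theta u v]
     equals [theta u v']. *)
  pose v' := v - theta v f *: e + theta v e *: f.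
  have vE : v = v' + theta v f *: e - theta v e *: f.
    by rewrite /v' addrAC addrK subrK.
  rewrite vE linearBr linearDr !linearZr_LR /= ue uf !mulr0 subr0 addr0 u0 //.
  rewrite U'P /v' !linearDl !linearNl !linearZl_LR /=.
  rewrite ef !skewxx (skewC _ f e) ef.
  by rewrite !(mulr1, mulr0, mulrN1, subr0, addr0, subrr) eqxx !andbT
             rpredD ?rpredB ?memvZ.
exists (fun i => if i is j.+1 then x j else e),
       (fun i => if i is j.+1 then y j else f); split; last first.
  case=> // i iq; have [] := xyU i iq; rewrite !U'P.
  by move=> /and3P[-> _ _] /and3P[-> _ _].
have perp i : (i < q)%N -> [/\ theta (x i) e = 0, theta (x i) f = 0,
    theta (y i) e = 0 & theta (y i) f = 0].
  move=> iq; have [] := xyU i iq; rewrite !U'P.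
  by move=> /and3P[_ /eqP-> /eqP->] /and3P[_ /eqP-> /eqP->].
move=> [|i] [|j] iq jq.
- by rewrite !skewxx ef skewC ef.
- have [xe xf ye yf] := perp j jq.
  by rewrite !(skewC _ e) !(skewC _ f) xe xf ye yf oppr0.
- have [xe xf ye yf] := perp i iq.
  by rewrite xe xf ye yf oppr0.
exact: D.
Qed.

Lemma contact_form_of_extension (K : numFieldType) (g h : lieAlgType K)
    (theta : symplectic_form h) p :
  \dim {: h} = (2 * p)%N -> lie_isomorphic g (central_ext theta) ->
  exists w : {scalar g}, contact_form p w.
Proof.
move=> dim_h [f [[fi fK fiK] f_lie]].
have wL : scalar (fun x => (f x).2 : K) by move=> c x y; rewrite linearP.
pose w : {scalar g} := HB.pack (fun x => (f x).2 : K)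
  (GRing.isLinear.Build K g K *%R (fun x => (f x).2 : K) wL).
have [||x [y [D _]]] := @darboux_exists _ _ theta p fullv.
- by rewrite dim_h mulnC.
- move=> u _ u0; apply/eqP; rewrite -memv0.
  rewrite -(eqP (symplectic_nondegenerate theta)).
  by apply/mem_orthovP => v; rewrite u0 ?memvf.
pose up (z : nat -> h) i := fi (z i, 0).
(* The central vector comes first. The roles of [x] and [y] are exchanged because $d\omega=-\theta$
   on the lifts. *)
pose v (i : 'I_(1 + p * 2)) :=
  if i is Ordinal j.+1 _ then interleave (up y) (up x) j else fi (0, 1).
have w_lie a b : w [lie a, b] = theta (f a).1 (f b).1 by rewrite /= f_lie.
exists w, v; apply/lt0r_neq0/wedge_form1_gt0.
- exact: wedge_exp_antisymmetric.
- by rewrite /v /= fiK ltr01.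
- by move=> i; rewrite /v /= /interleave; case: odd; rewrite /up fiK.
(* [form2] of this function is [dform1 w] by conversion. *)
apply: (@wedge_exp_form2_gt0 _ _ (fun a b => - w [lie a, b]) p (up y) (up x)).
move=> i j ip jp; rewrite !w_lie /up !fiK /=.
have [-> -> -> ->] := D i j ip jp.
by rewrite oppr0 opprK.
Qed.

(** * Central elements, and the lower central series under morphisms *)

Section LieTheory.
Variables (K : fieldType) (g : lieAlgType K).
Implicit Types x y : g.

Lemma lieC x y : [lie x, y] = - [lie y, x].
Proof.
have := lie_bracketxx (x + y).
rewrite linearDl !linearDr /= !lie_bracketxx add0r addr0 => /eqP.
by rewrite addr_eq0 => /eqP.
Qed.

Definition central x := forall y, [lie x, y] = 0.

Lemma lower_central_last k x y :
  lower_central g k.+1 = 0%VS -> x \in lower_central g k -> [lie x, y] = 0.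
Proof.
move=> lc0 lx; apply/eqP; rewrite lieC oppr_eq0 -memv0 -lc0.
by rewrite memv_lie ?memvf.
Qed.

End LieTheory.

Section LowerCentralMorphism.
Variables (K : fieldType) (g h : lieAlgType K) (f : {linear g -> h}).
Hypothesis f_lie : {morph f : x y / [lie x, y] >-> [lie x, y]}.

Lemma lower_central_morph i x :
  x \in lower_central g i -> f x \in lower_central h i.
Proof.
elim: i x => [|i IHi] x; first by rewrite !memvf.
suff /subvP sub :
    (lower_central g i.+1 <= linfun f @^-1: lower_central h i.+1)%VS.
  by move=> /sub; rewrite -memv_preim lfunE.
apply/lie_prodvP => u v _ /IHi lv; rewrite -memv_preim lfunE /= f_lie.
by rewrite memv_lie ?memvf.
Qed.

Lemma lower_central_surj i : (forall y, exists x, f x = y) ->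
  forall y, y \in lower_central h i ->
    exists2 x, x \in lower_central g i & f x = y.
Proof.
move=> f_surj; elim: i => [|i IHi] y.
  by have [x <-] := f_surj y; exists x; rewrite ?memvf.
suff /subvP sub : (lower_central h i.+1 <= linfun f @: lower_central g i.+1)%VS.
  by move=> /sub /memv_imgP[x lx ->]; exists x; rewrite // lfunE.
apply/lie_prodvP => u v _ /IHi [x lx <-]; have [t <-] := f_surj u.
by apply/memv_imgP; exists [lie t, x]; rewrite ?lfunE ?f_lie // memv_lie ?memvf.
Qed.

End LowerCentralMorphism.

(** * The radical of a contact form *)

Section ContactRadical.
Variables (K : numFieldType) (g : lieAlgType K) (w : {scalar g}).

Lemma form1_multilinear : multilinear (form1 w).
Proof. by move=> i v c x y; rewrite /form1 /set_slot (ord1 i) /= linearP. Qed.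

Lemma dform1_multilinear : multilinear (dform1 w).
Proof.
move=> i v c x y; rewrite /dform1 /set_slot.
case: i => -[|[|//]] ?; rewrite -!val_eqE /=.
  by rewrite linearPl linearP opprD mulrN.
by rewrite linearPr linearP opprD mulrN.
Qed.

(** Such a [y] is in the radical of both $\omega$ and $d\omega$, hence of their wedge product, whose
    degree $2p+1$ is at least $\dim\mathfrak g$. *)
Lemma contact_form_radical p y :
    (\dim {: g} <= (2 * p).+1)%N -> contact_form p w ->
    w y = 0 -> (forall x, w [lie y, x] = 0) ->
  y = 0.
Proof.
move=> dim_g [v wv] wy wdy.
apply: (antisymmetric_form_radical _ _ _ _ _ wv); rewrite ?pnatr_eq0 //.
- by rewrite add1n mulnC.
- apply: wedge_multilinear; first exact: form1_multilinear.
  exact/wedge_exp_multilinear/dform1_multilinear.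
- exact: wedge_antisymmetric.
apply: wedge_in_radical; last apply: wedge_exp_in_radical.
  by move=> i u; rewrite /form1 /set_slot (ord1 i).
move=> i u; rewrite /dform1 /set_slot.
case: i => -[|[|//]] ?; rewrite -!val_eqE /= ?wdy ?oppr0 //.
by rewrite lieC linearN opprK wdy.
Qed.

End ContactRadical.

(** * The quotient by a central line and its symplectic cocycle *)

Section Reduction.
Variables (K : numFieldType) (g : lieAlgType K) (w : {scalar g}) (z : g).
Hypotheses (wz : w z = 1) (cz : central z).

Let U := lker (linfun (w : g -> K^o)).

(* The quotient of g by the line spanned by z, realised on the hyperplane
   ker w; it takes the hypotheses as arguments because its Lie structure
   depends on them. *)
Definition reduction of w z = 1 & central z : Type := subvs_of U.

Local Notation h := (reduction wz cz).

HB.instance Definition _ := Vector.copy h (subvs_of U).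

(** The projection along [z]: as $\omega(z)=1$, the argument of [vsproj] already lies in the
    hyperplane. *)
Definition reduce (x : g) : h := vsproj U (x - w x *: z).
Definition lift_red (a : h) : g := vsval a.

Fact reduce_linear : linear reduce.
Proof.
move=> c x y; rewrite /reduce linearP scalerDl -scalerA opprD addrACA -scalerBr.
exact: linearP.
Qed.
HB.instance Definition _ := GRing.isLinear.Build K g h *:%R reduce reduce_linear.

Fact lift_red_linear : linear lift_red.
Proof. by move=> c a b; apply: linearP. Qed.
HB.instance Definition _ :=
  GRing.isLinear.Build K h g *:%R lift_red lift_red_linear.

Lemma mem_hyperplane x : (x \in U) = (w x == 0).
Proof. by rewrite memv_ker lfunE. Qed.

Lemma w_lift_red a : w (lift_red a) = 0.
Proof. by have := subvsP a; rewrite mem_hyperplane => /eqP. Qed.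

Lemma reduceK x : lift_red (reduce x) = x - w x *: z.
Proof.
rewrite /lift_red vsprojK // mem_hyperplane.
by rewrite linearB linearZ_LR /= wz mulr1 subrr.
Qed.

Lemma lift_redK : cancel lift_red reduce.
Proof.
by move=> a; rewrite /reduce w_lift_red scale0r subr0 /lift_red vsvalK.
Qed.

Lemma reduce_center : reduce z = 0.
Proof. by rewrite /reduce wz scale1r subrr linear0. Qed.

(** Lifting a class changes the vector by a multiple of the central [z], which brackets ignore.
    Identities of [g] descend to the quotient this way. *)
Lemma lie_reducel x y : [lie lift_red (reduce x), y] = [lie x, y].
Proof. by rewrite reduceK linearBl linearZl_LR /= cz scaler0 subr0. Qed.

Lemma lie_reducer x y : [lie x, lift_red (reduce y)] = [lie x, y].
Proof. by rewrite lieC lie_reducel -lieC. Qed.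

Definition red_bracket (a b : h) : h := reduce [lie lift_red a, lift_red b].

Fact red_bracket_bilinear : bilinear_for *:%R *:%R red_bracket.
Proof.
by split=> u c x y; rewrite /red_bracket linearP ?linearPl ?linearPr linearP.
Qed.

Fact red_bracketxx a : red_bracket a a = 0.
Proof. by rewrite /red_bracket lie_bracketxx linear0. Qed.

Fact red_jacobi a b c :
  red_bracket a (red_bracket b c) + red_bracket b (red_bracket c a)
    + red_bracket c (red_bracket a b) = 0.
Proof. by rewrite /red_bracket !lie_reducer -!linearD lie_jacobi linear0. Qed.

HB.instance Definition _ := Vector_isLieAlgebra.Build K h
  red_bracket_bilinear red_bracketxx red_jacobi.

Lemma red_lieE (a b : h) : [lie a, b] = reduce [lie lift_red a, lift_red b].
Proof. by []. Qed.

Lemma reduce_lie : {morph reduce : x y / [lie x, y] >-> [lie x, y]}.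
Proof. by move=> x y; rewrite red_lieE lie_reducel lie_reducer. Qed.

(** Rank-nullity for [w], which is onto because $\omega(z)=1$. *)
Lemma dim_reduction : \dim {: h} = (\dim {: g}).-1.
Proof.
have -> : \dim {: h} = \dim U by rewrite dimvf.
have := limg_ker_dim (linfun (w : g -> K^o)) fullv; rewrite capfv -/U.
have -> : (linfun (w : g -> K^o) @: fullv)%VS = fullv.
  apply/eqP; rewrite eqEsubv subvf; apply/subvP => c _; apply/memv_imgP.
  exists (c *: z); rewrite ?memvf // lfunE; apply: esym.
  by have := linearZ_LR w c z; rewrite /= wz mulr1.
by rewrite dimvf [dim _]/= => <-; rewrite addn1.
Qed.

(** The failure of [lift_red] to be a Lie morphism:
    $[\tilde a,\tilde b]=\widetilde{[a,b]}+\theta(a,b)z$, where the tilde is [lift_red]. *)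
Definition red_form (a b : h) : K := w [lie lift_red a, lift_red b].

Fact red_form_bilinear : bilinear_for *%R (idfun \; *%R) red_form.
Proof.
by split=> u c x y; rewrite /red_form linearP ?linearPl ?linearPr linearP.
Qed.
HB.instance Definition _ := bilinear_isBilinear.Build K h h K *%R (idfun \; *%R)
  red_form red_form_bilinear.

Fact red_form_skew a b : red_form a b = (-1) ^+ true * idfun (red_form b a).
Proof. by rewrite /red_form lieC linearN mulN1r. Qed.
HB.instance Definition _ := isHermitianSesquilinear.Build K h true idfun
  red_form red_form_skew.

(** This is [w] applied to the Jacobi identity of [g]. *)
Fact red_form_closed a b c :
  red_form [lie a, b] c + red_form [lie b, c] a + red_form [lie c, a] b = 0.
Proof.
pose A := lift_red a; pose B := lift_red b; pose C := lift_red c.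
rewrite /red_form !red_lieE !lie_reducel -!linearD.
rewrite (lieC [lie A, B] C) (lieC [lie B, C] A) (lieC [lie C, A] B).
rewrite -!opprD linearN [X in w X](_ : _ = 0) ?linear0 ?oppr0 //.
by rewrite -addrA addrC lie_jacobi.
Qed.

Definition red_cocycle : cocycle2 h := Cocycle2 red_form_closed.

(** A vector is determined by its class modulo [z] and its [w]-coordinate; the inverse is
    $(a,c)\mapsto\tilde a+cz$. *)
Lemma reduction_iso : lie_isomorphic g (central_ext red_cocycle).
Proof.
pose f (x : g) : central_ext red_cocycle := (reduce x, w x).
have f_linear : linear f by move=> c x y; congr pair; apply: linearP.
pose F : {linear g -> central_ext red_cocycle} :=
  HB.pack f (GRing.isLinear.Build K g _ *:%R f f_linear).
exists F; split; last first.
  move=> x y; congr pair; rewrite ?reduce_lie //=.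
  by rewrite /red_form lie_reducel lie_reducer.
exists (fun u => lift_red u.1 + u.2 *: z) => [x|[a c]] /=.
  by rewrite reduceK subrK.
congr pair; rewrite linearD linearZ /=.
  by rewrite lift_redK reduce_center scaler0 addr0.
by rewrite w_lift_red wz mulr1 add0r.
Qed.

End Reduction.

(** A radical vector lifts into $\ker\omega$. Its pairing vanishes against all of [g], not only the
    hyperplane, because the two differ by the central line. *)
Lemma red_cocycle_nondegenerate (K : numFieldType) (g : lieAlgType K)
    (w : {scalar g}) z (wz : w z = 1) (cz : central z) :
    (forall x, w x = 0 -> (forall y, w [lie x, y] = 0) -> x = 0) ->
  nondegenerate (red_cocycle wz cz).
Proof.
move=> w_rad; rewrite /nondegenerate -subv0; apply/subvP => a.
move=> /mem_orthovP a_rad; rewrite memv0 -(lift_redK a) (w_rad (lift_red a)).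
- by rewrite linear0.
- exact: w_lift_red.
move=> y; rewrite -(lie_reducer wz cz).
exact: (a_rad (reduce wz cz y) (memvf _)).
Qed.

(** Term [k] of the series of [g] is central, hence in the line of [z], and dies in the quotient.
    Conversely, if term [i] dies there, it lies on that line in [g], so term [i.+1] of [g]
    vanishes. *)
Lemma reduction_step_nilpotent (K : numFieldType) (g : lieAlgType K)
    (w : {scalar g}) z (wz : w z = 1) (cz : central z) k :
    step_nilpotent g k.+1 -> (forall x, central x -> x = w x *: z) ->
  step_nilpotent (reduction wz cz) k.
Proof.
move=> [lck lc_neq0] center_z.
have red_lie := reduce_lie wz cz; split.
  apply/eqP; rewrite -subv0; apply/subvP => a.
  have red_surj b : exists x, reduce wz cz x = b.
    by exists (lift_red b); exact: lift_redK.
  case/(lower_central_surj red_lie red_surj) => x lx <-; rewrite memv0.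
  rewrite (center_z x); last by move=> y; exact: lower_central_last lx.
  by rewrite linearZ_LR /= reduce_center scaler0.
move=> i ik lci0; apply: (lc_neq0 i.+1) => //; apply/eqP; rewrite -subv0.
apply/lie_prodvP => u x _ /(lower_central_morph red_lie).
rewrite lci0 memv0 => /eqP rx0; have := reduceK wz cz x.
rewrite rx0 linear0 lieC => /esym/subr0_eq ->.
by rewrite linearZl_LR /= cz scaler0 oppr0 mem0v.
Qed.

Theorem theorem21 (R : realType) (K : numFieldType)
    (K_RC : K = (R : numFieldType) \/ K = (R[i] : numFieldType))
    (p k : nat) (p_gt0 : (1 <= p)%N) (g : lieAlgType K)
    (dim_g : \dim {: g} = (2 * p).+1) (nil_g : step_nilpotent g k) :
  (exists w : {scalar g}, contact_form p w) <->
  (exists (h : lieAlgType K) (theta : symplectic_form h),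
     [/\ \dim {: h} = (2 * p)%N, step_nilpotent h (k - 1)
       & lie_isomorphic g (central_ext theta)]).
Proof.
split=> [[w wP]|[h [theta [dim_h _ gh]]]]; last first.
  exact: contact_form_of_extension dim_h gh.
(* The case [k = 0] means $\mathfrak g=0$, against the odd dimension, so [k - 1] is never
   truncated. *)
case: k nil_g => [[/= lc0 _]|k nil_g].
  by have := dim_g; rewrite lc0 dimv0.
have w_rad x : w x = 0 -> (forall y, w [lie x, y] = 0) -> x = 0.
  by apply: contact_form_radical wP; rewrite dim_g.
have w_center x : central x -> w x = 0 -> x = 0.
  by move=> cx wx; apply: w_rad => // y; rewrite cx linear0.
have [lck lc_neq0] := nil_g.
(* A nonzero vector of the last nonzero term, hence central; [w] does not vanish on it, so it can be
   rescaled to $\omega(z)=1$. *)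
pose c := vpick (lower_central g k).
have cc : central c by move=> y; apply: lower_central_last (memv_pick _).
have wc : w c != 0.
  apply: contra_not_neq (lc_neq0 k (ltnSn k)) => /(w_center _ cc)/eqP.
  by rewrite vpick0 => /eqP.
pose z := (w c)^-1 *: c.
have wz : w z = 1 by rewrite linearZ_LR /= mulVf.
have cz : central z by move=> y; rewrite linearZl_LR /= cc scaler0.
exists (reduction wz cz).
have nd := red_cocycle_nondegenerate wz cz w_rad.
exists (SymplecticForm nd); split; first by rewrite dim_reduction dim_g.
  (* The centre is the line of [z]: for central [x], the vector $x-\omega(x)z$ is central and killed
     by [w], hence zero. *)
  rewrite subn1; apply: reduction_step_nilpotent nil_g _ => x cx.
  apply/subr0_eq/w_center => [y|].
    by rewrite linearBl linearZl_LR /= cx cz scaler0 subrr.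
  by rewrite linearB linearZ_LR /= wz mulr1 subrr.
exact: reduction_iso.
Qed.
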